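(* Let $\alpha$ be a positive integer, $\gamma$ a positive integer, and $\varepsilon\in\{1,-1\}$. Let $F(z)$ be a formal power series with integer coefficients satisfying $$c_2(z)F^2(z)+c_1(z)F(z)+c_0(z)+3\,\mathcal Q\bigl(z;F(z),F'(z),\dots,F^{(s)}(z)\bigr)=0,$$ where $c_0,c_1,c_2\in\mathbb Z[z]$ and: (1) $c_2(z)\equiv z^{e_1}(1+\varepsilon z^\gamma)^{e_2}$ modulo $3$ for some non-negative integers $e_1,e_2$; (2) $c_1^2(z)-c_0(z)c_2(z)\equiv z^{2f_1}(1+\varepsilon z^\gamma)^{2f_2+1}$ modulo $3$ for some non-negative integers $f_1,f_2$; (3) $\mathcal Q$ is a polynomial with integer coefficients; (4) the equation determines its power series solution uniquely modulo $3^{3^\alpha}$, i.e. any two formal power series with integer coefficients that satisfy the equation modulo $3^{3^\alpha}$ agree modulo $3^{3^\alpha}$. Then there exist $a_0(z),\dots,a_{2\cdot3^\alpha-1}(z)\in\mathbb Z[z,z^{-1},(1+\varepsilon z^\gamma)^{-1}]$ such that $$F(z)=\sum_{i=0}^{2\cdot3^\alpha-1}a_i(z)\Psi^i(\varepsilon z^\gamma)\quad\text{modulo }3^{3^\alpha}.$$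
   Context: $\Psi(z)=\prod_{j\ge0}(1+z^{3^j})$, so $\Psi(\varepsilon z^\gamma)=\prod_{j\ge0}(1+(\varepsilon z^\gamma)^{3^j})$. Congruences ''modulo $3^e$'' between integral (Laurent) series in $z$ are coefficientwise; rational functions are expanded as Laurent series in $z$. *)

(* Defs.v *)
From mathcomp Require Import all_boot all_order all_algebra.
Set Implicit Arguments. Unset Strict Implicit. Unset Printing Implicit Defensive.
Import GRing.Theory Num.Theory.
Local Open Scope ring_scope.

Definition series := nat -> int.

Definition ser_zero : series := fun _ => 0.
Definition ser_one : series := fun n => if n == 0%N then 1 else 0.
Definition ser_add (f g : series) : series := fun n => f n + g n.
Definition ser_scale (c : int) (f : series) : series := fun n => c * f n.
Definition ser_mul (f g : series) : series :=
  fun n => \sum_(i < n.+1) f i * g (n - i)%N.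
Definition ser_pow (f : series) (k : nat) : series := iter k (ser_mul f) ser_one.
Definition ser_of_poly (p : {poly int}) : series := fun n => p`_n.
Definition ser_Xn (a : nat) : series := fun n => if n == a then 1 else 0.
Definition ser_deriv (f : series) : series := fun n => f n.+1 *+ n.+1.
Definition ser_derivn (j : nat) (f : series) : series := iter j ser_deriv f.

Definition ser_cong (M : int) (f g : series) : Prop :=
  forall n, (M %| f n - g n)%Z.

(* A polynomial Q(z; y_0, ..., y_s) with integer coefficients, given as a
   finite list of monomials (c, a, es) standing for c * z^a * prod_j y_j^(es_j)
   (exponents beyond position s are ignored; missing ones are 0). *)
Definition monomial := (int * nat * seq nat)%type.
Definition mpoly := seq monomial.

Definition eval_monomial (s : nat) (F : series) (mo : monomial) : series :=
  let: (c, a, es) := mo in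
  ser_scale c (ser_mul (ser_Xn a)
    (foldr (fun j acc => ser_mul (ser_pow (ser_derivn j F) (nth 0%N es j)) acc)
       ser_one (iota 0 s.+1))).

Definition eval_Q (s : nat) (Q : mpoly) (F : series) : series :=
  foldr (fun mo acc => ser_add (eval_monomial s F mo) acc) ser_zero Q.

Definition eqn_lhs (c0 c1 c2 : {poly int}) (s : nat) (Q : mpoly) (F : series)
  : series :=
  ser_add (ser_mul (ser_of_poly c2) (ser_mul F F))
   (ser_add (ser_mul (ser_of_poly c1) F)
     (ser_add (ser_of_poly c0) (ser_scale 3 (eval_Q s Q F)))).

(* Psi(eps z^gamma) = prod_{j>=0} (1 + (eps z^gamma)^(3^j)).  The coefficient of
   z^n only depends on the factors with gamma*3^j <= n, hence on j <= n; so the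
   coefficient of z^n is that of the finite product over j < n+1. *)
Definition psi (eps : int) (gamma : nat) : series :=
  fun n => (\prod_(j < n.+1) (1 + (eps%:P * 'X ^+ gamma) ^+ (3 ^ j)%N)
             : {poly int})`_n.

(* power series expansion of (1 + eps z^gamma)^{-1} = sum_k (-eps)^k z^(gamma k),
   for gamma > 0 *)
Definition inv_lin (eps : int) (gamma : nat) : series :=
  fun n => if (gamma %| n)%N then (- eps) ^+ (n %/ gamma)%N else 0.

(* An element of Z[z, z^{-1}, (1 + eps z^gamma)^{-1}] written as
   z^{-k} p(z) (1 + eps z^gamma)^{-m}, encoded as ((p, k), m). *)
Definition lelem := ({poly int} * nat * nat)%type.

(* Laurent coefficient at n : int of z^{-k} S(z), S a power series *)
Definition lcoef (k : nat) (S : series) (n : int) : int :=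
  if (0 <= n + k%:Z)%R then S (absz (n + k%:Z)) else 0.

Definition term_coef (eps : int) (gamma : nat) (a : lelem) (i : nat) (n : int)
  : int :=
  let: (p, k, m) := a in
  lcoef k (ser_mul (ser_of_poly p)
             (ser_mul (ser_pow (inv_lin eps gamma) m)
                      (ser_pow (psi eps gamma) i))) n.

Definition poly_cong (M : int) (p q : {poly int}) : Prop :=
  forall n, (M %| (p - q)`_n)%Z.

(* Main.v *)
(* Write W = 1 + eps z^gamma.  Since Psi(z) = (1 + z) Psi(z^3), Psi satisfies
   W Psi^3 = Psi, hence W Psi^2 = 1, modulo 3; so (W Psi^2 - 1)^N vanishes
   modulo 3^N, and modulo 3^N every polynomial in Psi over
   A = Z[z, 1/z, 1/W] has a representative of degree < 2 N.  The ring A[Psi] is,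
   modulo 3^N, closed under d/dz: the logarithmic derivative of Psi is, modulo
   3^N, the one of its N-th partial product, and that product is a power of W
   modulo 3, hence invertible over A modulo 3^N.

   Modulo 3 the equation becomes (c2 F - c1)^2 = c1^2 - c0 c2 =
   (z^f1 W^(f2+1) Psi)^2, so F lies in A[Psi] modulo 3.  The derivative
   2 c2 F + c1 of the quadratic part is then, up to sign, z^f1 W^(f2+1) Psi
   modulo 3, a unit of A[Psi] modulo 3, so that a Newton step lifts a
   representation of F modulo 3^b to one modulo 3^(b+1). *)
Require Import Defs.
From HB Require Import structures.
From mathcomp Require Import all_boot all_order all_algebra.
From mathcomp Require Import boolp ring zify.
Set Implicit Arguments.
Unset Strict Implicit.
Unset Printing Implicit Defensive.
Import GRing.Theory Num.Theory.
Local Open Scope ring_scope.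

(** * The ring of integral power series *)

(** Carries the ring laws over from [{poly int}]: the coefficients of a product up to [z^n] only
    depend on the factors truncated after [z^n]. *)
Definition trunc (n : nat) (f : series) : {poly int} := \poly_(i < n.+1) f i.

Lemma coef_trunc n (f : series) i : (i <= n)%N -> (trunc n f)`_i = f i.
Proof. by move=> le_in; rewrite coef_poly ltnS le_in. Qed.

Lemma ser_mulE (f g : series) (m n : nat) : (n <= m)%N ->
  ser_mul f g n = (trunc m f * trunc m g)`_n.
Proof.
move=> le_nm; rewrite coefM; apply: eq_bigr => -[i /= lt_in] _.
by rewrite !coef_trunc //; lia.
Qed.

Lemma coef_trunc_mul f g m n : (n <= m)%N ->
  (trunc m (ser_mul f g))`_n = (trunc m f * trunc m g)`_n.
Proof. by move=> le_nm; rewrite coef_trunc // (ser_mulE _ _ le_nm). Qed.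

HB.instance Definition _ := gen_eqMixin series.
HB.instance Definition _ := gen_choiceMixin series.

Fact ser_addA : associative ser_add.
Proof. by move=> f g h; apply/funext => n; apply: addrA. Qed.
Fact ser_addC : commutative ser_add.
Proof. by move=> f g; apply/funext => n; apply: addrC. Qed.
Fact ser_add0 : left_id ser_zero ser_add.
Proof. by move=> f; apply/funext => n; apply: add0r. Qed.
Fact ser_addN : left_inverse ser_zero (fun f n => - f n) ser_add.
Proof. by move=> f; apply/funext => n; apply: addNr. Qed.

HB.instance Definition _ :=
  GRing.isZmodule.Build series ser_addA ser_addC ser_add0 ser_addN.

Fact ser_mulA : associative ser_mul.
Proof.
move=> f g h; apply/funext => n; rewrite !(ser_mulE _ _ (leqnn n)).
transitivity ((trunc n f * trunc n g * trunc n h)`_n); last first.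
  rewrite !coefM; apply: eq_bigr => -[i /= lt_in] _.
  by rewrite coef_trunc_mul.
rewrite -mulrA !coefM; apply: eq_bigr => -[i /= lt_in] _.
by rewrite coef_trunc_mul // leq_subr.
Qed.

Fact ser_mulC : commutative ser_mul.
Proof.
by move=> f g; apply/funext => n; rewrite !(ser_mulE _ _ (leqnn n)) mulrC.
Qed.

Fact ser_mul1 : left_id ser_one ser_mul.
Proof.
move=> f; apply/funext => n; rewrite /ser_mul big_ord_recl /= subn0 mul1r.
by rewrite big1 ?addr0 // => i _; rewrite mul0r.
Qed.

Fact ser_mulDl : left_distributive ser_mul ser_add.
Proof.
move=> f g h; apply/funext => n; rewrite /ser_mul /ser_add -big_split /=.
by apply: eq_bigr => i _; rewrite mulrDl.
Qed.

Fact ser_one_neq0 : ser_one != ser_zero.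
Proof. by apply/eqP => /(congr1 (fun f : series => f 0%N)). Qed.

HB.instance Definition _ := GRing.Zmodule_isComNzRing.Build series
  ser_mulA ser_mulC ser_mul1 ser_mulDl ser_one_neq0.

Lemma ser_powE (f : series) n : ser_pow f n = f ^+ n.
Proof. by elim: n => // n IHn; rewrite exprS -IHn. Qed.

Lemma coef_serD (f g : series) n : (f + g) n = f n + g n. Proof. by []. Qed.
Lemma coef_serN (f : series) n : (- f) n = - f n. Proof. by []. Qed.
Lemma coef_serMn (f : series) k n : (f *+ k) n = f n *+ k.
Proof. by elim: k => // k IHk; rewrite !mulrS coef_serD IHk. Qed.
Lemma coef_ser_sum I (r : seq I) (E : I -> series) n :
  (\sum_(i <- r) E i) n = \sum_(i <- r) E i n.
Proof. by elim/big_rec2: _ => // i y1 y2 _ <-. Qed.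

Fact ser_of_poly_is_zmod_morphism : zmod_morphism ser_of_poly.
Proof. by move=> p q; apply/funext => n; rewrite /ser_of_poly coefB. Qed.

Fact ser_of_poly_is_monoid_morphism : monoid_morphism ser_of_poly.
Proof.
split=> [|p q]; apply/funext => n; rewrite /ser_of_poly.
  by rewrite coef1; case: n.
by rewrite coefM.
Qed.

HB.instance Definition _ :=
  GRing.isZmodMorphism.Build {poly int} series ser_of_poly
    ser_of_poly_is_zmod_morphism.
HB.instance Definition _ :=
  GRing.isMonoidMorphism.Build {poly int} series ser_of_poly
    ser_of_poly_is_monoid_morphism.

Lemma ser_XnE a : ser_Xn a = ser_of_poly 'X^a.
Proof.
by apply/funext => n; rewrite /ser_of_poly coefXn /ser_Xn; case: eqP.
Qed.

Lemma coef_serXnM k (f : series) n :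
  (ser_of_poly 'X^k * f) n = if (n < k)%N then 0 else f (n - k)%N.
Proof.
transitivity (('X^k * trunc n f)`_n); last first.
  by rewrite coefXnM; case: ifP => // _; rewrite coef_trunc // leq_subr.
rewrite coefM; apply: eq_bigr => i _.
by rewrite coef_trunc // leq_subr.
Qed.

Lemma coef_ser_natM (c : nat) (f : series) n : (c%:R * f) n = c%:R * f n.
Proof. by rewrite mulr_natl coef_serMn mulr_natl. Qed.

Lemma ser_scaleE (c : int) (f : series) : ser_scale c f = ser_of_poly c%:P * f.
Proof.
apply/funext => n.
transitivity ((c%:P * trunc n f)`_n).
  by rewrite coefCM coef_trunc.
rewrite coefM; apply: eq_bigr => i _.
by rewrite coef_trunc // leq_subr.
Qed.

Lemma ser_derivD (f g : series) : ser_deriv (f + g) = ser_deriv f + ser_deriv g.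
Proof. by apply/funext => n; rewrite /ser_deriv coef_serD mulrnDl. Qed.

Lemma ser_derivM (f g : series) :
  ser_deriv (f * g) = ser_deriv f * g + f * ser_deriv g.
Proof.
apply/funext => n; rewrite coef_serD.
have derivE h i : (i <= n)%N -> (trunc n.+1 h)^`()`_i = ser_deriv h i.
  by move=> le_in; rewrite coef_deriv coef_trunc.
transitivity ((trunc n.+1 f * trunc n.+1 g)^`()`_n).
  by rewrite coef_deriv -(ser_mulE _ _ (leqnn n.+1)).
rewrite derivM coefD !coefM; congr (_ + _); apply: eq_bigr => -[i /= lt_in] _.
  by rewrite derivE // coef_trunc //; lia.
by rewrite derivE ?coef_trunc //; lia.
Qed.

Lemma ser_deriv_poly p : ser_deriv (ser_of_poly p) = ser_of_poly p^`().
Proof. by apply/funext => n; rewrite /ser_of_poly coef_deriv. Qed.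


(** * Congruences *)

(** The quotient is kept as a witness, so that congruences of polynomials and of series are both
    handled by ring identities. *)
Definition eqmod (R : comPzRingType) (M x y : R) := exists h, x = y + M * h.

Section EqmodTheory.
Variables (R : comPzRingType) (M : R).
Implicit Types x y z : R.

Lemma eqmod_refl x : eqmod M x x.
Proof. by exists 0; ring. Qed.

Lemma eqmod_sym x y : eqmod M x y -> eqmod M y x.
Proof. by case=> h ->; exists (- h); ring. Qed.

Lemma eqmod_trans y x z : eqmod M x y -> eqmod M y z -> eqmod M x z.
Proof. by case=> h -> [k ->]; exists (k + h); ring. Qed.

Lemma eqmodD x y x' y' :
  eqmod M x y -> eqmod M x' y' -> eqmod M (x + x') (y + y').
Proof. by case=> h -> [k ->]; exists (k + h); ring. Qed.

Lemma eqmodM x y x' y' :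
  eqmod M x y -> eqmod M x' y' -> eqmod M (x * x') (y * y').
Proof. by case=> h -> [k ->]; exists (y * k + h * y' + M * h * k); ring. Qed.

Lemma eqmodMl z x y : eqmod M x y -> eqmod M (z * x) (z * y).
Proof. exact/eqmodM/eqmod_refl. Qed.

Lemma eqmodX n x y : eqmod M x y -> eqmod M (x ^+ n) (y ^+ n).
Proof.
move=> xy; elim: n => [|n IHn]; first exact: eqmod_refl.
by rewrite !exprS; apply: eqmodM.
Qed.

Lemma eqmod_subr0 x y : eqmod M x y <-> eqmod M (x - y) 0.
Proof.
split=> -[h]; first by move->; exists h; ring.
by rewrite add0r => xy; exists h; rewrite -xy; ring.
Qed.
End EqmodTheory.

Lemma eqmod_exp0 (R : comPzRingType) (M x : R) n :
  eqmod M x 0 -> eqmod (M ^+ n) (x ^+ n) 0.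
Proof. by case=> h ->; exists (h ^+ n); rewrite !add0r exprMn. Qed.

Lemma eqmod_dvd (R : comPzRingType) (M' M x y : R) :
  eqmod (M * M') x y -> eqmod M x y.
Proof. by case=> h ->; exists (M' * h); ring. Qed.

Lemma eqmod_rmorph (R S : comPzRingType) (f : {rmorphism R -> S}) (M x y : R) :
  eqmod M x y -> eqmod (f M) (f x) (f y).
Proof. by case=> h ->; exists (f h); rewrite rmorphD rmorphM. Qed.

Lemma eqmod_serP (c : nat) (f g : series) :
  eqmod c%:R f g <-> ser_cong c%:R f g.
Proof.
split=> [[h ->] n | fg].
  by rewrite coef_serD coef_ser_natM addrC addKr dvdz_mulr.
exists (fun n => ((f n - g n) %/ c%:R)%Z); apply/funext => n.
rewrite coef_serD coef_ser_natM mulrC divzK; last exact: fg.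
by rewrite addrC subrK.
Qed.

Lemma eqmod_polyP (c : nat) (p q : {poly int}) :
  poly_cong c%:R p q <-> eqmod c%:R p q.
Proof.
split=> [pq | [h ->] n]; last first.
  by rewrite addrC addKr -polyC_natr coefCM dvdz_mulr.
exists (\poly_(i < size (p - q)) ((p - q)`_i %/ c%:R)%Z); apply/polyP => n.
rewrite coefD -polyC_natr coefCM coef_poly.
case: ltnP => [_ | /(nth_default 0)]; rewrite coefB.
  by rewrite mulrC divzK -?coefB ?pq // coefB addrC subrK.
by move/eqP; rewrite subr_eq0 mulr0 addr0 => /eqP.
Qed.

Lemma eqmod_deriv (c : nat) (f g : series) :
  eqmod c%:R f g -> eqmod c%:R (ser_deriv f) (ser_deriv g).
Proof.
move/eqmod_serP=> fg; apply/eqmod_serP => n.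
by rewrite /ser_deriv -mulrnBl rpredMn.
Qed.

(** Series over F_p form a domain: if [i] and [j] are the least indices at which [f] and [g] have
    coefficients prime to [p], the coefficient of [f * g] at [i + j] is [f i * g j] plus multiples
    of [p]. *)
Lemma eqmod_ser_mul_eq0 (p : nat) (f g : series) : prime p ->
  eqmod p%:R (f * g) 0 -> eqmod p%:R f 0 \/ eqmod p%:R g 0.
Proof.
move=> p_pr /eqmod_serP fg0.
have least (h : series) : ~ eqmod p%:R h 0 ->
    exists2 i, ~~ (p%:Z %| h i)%Z & forall j, (j < i)%N -> (p%:Z %| h j)%Z.
  move=> h0; have [ex_i|none] := pselect (exists i, ~~ (p%:Z %| h i)%Z).
    have [i hi min_i] := ex_minnP ex_i; exists i => // j lt_ji.
    by apply: contraLR lt_ji => /min_i; rewrite -leqNgt.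
  case: h0; apply/eqmod_serP => n; rewrite subr0 natz.
  by apply: contrapT => /negP hn; apply: none; exists n.
have [|/least[i fi min_i]] := pselect (eqmod p%:R f 0); first by left.
have [|/least[j gj min_j]] := pselect (eqmod p%:R g 0); first by right.
have lt_i : (i < (i + j).+1)%N by lia.
have := fg0 (i + j)%N; rewrite subr0 /GRing.mul /= /ser_mul natz.
rewrite (bigD1 (Ordinal lt_i)) //= addKn rpredDr; last first.
  apply: rpred_sum => -[k lt_k] ne_ki; have {}ne_ki : (k != i :> nat)%N by [].
  have [lt_ki|le_ik] := ltnP k i; first by rewrite dvdz_mulr // min_i.
  by rewrite dvdz_mull // min_j /=; lia.
rewrite dvdzE abszM Euclid_dvdM // -!dvdzE.
by rewrite (negPf fi) (negPf gj).
Qed.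

Lemma coef_mul_agree n (p q : {poly int}) (f g : series) :
    (forall i, (i <= n)%N -> p`_i = f i) ->
    (forall i, (i <= n)%N -> q`_i = g i) ->
  forall i, (i <= n)%N -> (p * q)`_i = (f * g) i.
Proof.
move=> pf qg i le_in; rewrite coefM; apply: eq_bigr => -[j /= lt_ji] _.
by rewrite pf ?qg //; lia.
Qed.

(** * The series Psi *)

Section Psi.
Variables (eps : int) (gamma : nat).
Hypotheses (eps_unit : eps = 1 \/ eps = -1) (gamma_gt0 : (0 < gamma)%N).

Definition wpoly : {poly int} := eps%:P * 'X ^+ gamma.
Definition Wpoly : {poly int} := 1 + wpoly.
Definition psi_prod (n : nat) : {poly int} :=
  \prod_(j < n) (1 + wpoly ^+ (3 ^ j)).

Lemma eps_exp3 j : eps ^+ (3 ^ j) = eps.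
Proof.
elim: j => [|j IHj]; first by rewrite expr1.
by rewrite expnSr exprM IHj; case: eps_unit => ->.
Qed.

Lemma wpoly_exp j : wpoly ^+ (3 ^ j) = eps%:P * 'X ^+ (gamma * 3 ^ j).
Proof. by rewrite exprMn -exprM -rmorphXn /= eps_exp3. Qed.

(** The factor of index [n] is [1 + eps z^(gamma 3^n)] with [gamma 3^n >= n], so it changes no
    coefficient below [z^n]. *)
Lemma coef_psi_prod n i : (i < n)%N -> (psi_prod n)`_i = psi eps gamma i.
Proof.
elim: n i => // n IHn i; rewrite ltnS leq_eqVlt => /predU1P[-> // | lt_in].
rewrite /psi_prod big_ord_recr /= -/(psi_prod n) mulrDr mulr1 coefD IHn //.
rewrite wpoly_exp mulrCA coefCM coefMXn.
have le_n : (n <= gamma * 3 ^ n)%N.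
  exact: leq_trans (ltnW (ltn_expl n _)) (leq_pmull _ gamma_gt0).
by rewrite (leq_trans lt_in le_n) mulr0 addr0.
Qed.

Lemma psi_prodS n :
  psi_prod n.+1 = Wpoly * \prod_(j < n) (1 + wpoly ^+ (3 ^ j.+1)).
Proof. by rewrite /psi_prod big_ord_recl expr1. Qed.

Lemma Wpoly_frobenius j : eqmod 3%:R (Wpoly ^+ (3 ^ j)) (1 + wpoly ^+ (3 ^ j)).
Proof.
elim: j => [|j IHj]; first by rewrite !expr1; apply: eqmod_refl.
rewrite expnSr !exprM; apply: eqmod_trans (eqmodX 3 IHj) _.
by exists (wpoly ^+ (3 ^ j) + wpoly ^+ (3 ^ j) ^+ 2); ring.
Qed.

(** Cubing is additive modulo 3 and turns each factor into the next one; only the first factor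
    [Wpoly] has to be supplied. *)
Lemma psi_prod_cube n : eqmod 3%:R (Wpoly * psi_prod n ^+ 3) (psi_prod n.+1).
Proof.
rewrite psi_prodS; apply: eqmodMl; rewrite /psi_prod -prodrXl.
elim/big_ind2: _ => [|x x' y y' xx' yy'|j _]; first exact: eqmod_refl.
  exact: eqmodM.
exists (wpoly ^+ (3 ^ j) + wpoly ^+ (3 ^ j) ^+ 2).
by rewrite expnSr exprM; ring.
Qed.

Local Notation sop := ser_of_poly.
Local Notation Psi := (psi eps gamma).

(** Letting [n] grow in [psi_prod_cube] gives [W Psi^3 = Psi] modulo 3, and one [Psi] cancels
    because series modulo 3 form a domain. *)
Lemma psi_square : eqmod 3%:R (sop Wpoly * Psi ^+ 2) 1.
Proof.
have cube : eqmod 3%:R (sop Wpoly * Psi ^+ 3) Psi.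
  apply/eqmod_serP => n; rewrite -(coef_psi_prod (leqnSn n.+1)).
  have /eqmod_polyP/(_ n) := psi_prod_cube n.+1; rewrite coefB.
  suff -> : (Wpoly * psi_prod n.+1 ^+ 3)`_n = (sop Wpoly * Psi ^+ 3) n by [].
  have psiE i : (i <= n)%N -> (psi_prod n.+1)`_i = Psi i.
    by rewrite -ltnS; apply: coef_psi_prod.
  by rewrite !exprS !expr0 !mulr1; do 3![apply: (@coef_mul_agree n) => //].
have /(eqmod_ser_mul_eq0 (isT : prime 3))[] :
    eqmod 3%:R (Psi * (sop Wpoly * Psi ^+ 2 - 1)) 0.
- have -> : Psi * (sop Wpoly * Psi ^+ 2 - 1) = sop Wpoly * Psi ^+ 3 - Psi.
    by ring.
  exact: (eqmod_subr0 _ _ _).1.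
(* [Psi] is nonzero modulo 3, its constant term being 1. *)
- move/eqmod_serP/(_ 0%N); rewrite subr0 -(coef_psi_prod (ltnSn 0)).
  rewrite /psi_prod big_ord_recl big_ord0 mulr1 /wpoly expr1.
  rewrite coefD coefC coefCM coefXn (ltn_eqF gamma_gt0) mulr0 addr0.
  by rewrite dvdzE.
- exact: (eqmod_subr0 _ _ _).2.
Qed.

(** The product is a polynomial in [z^gamma], so differentiation brings out a factor [gamma]. It
    serves below with [gamma * 3 ^ N] in place of [gamma]. *)
Lemma eqmod_deriv_psi_prod0 n : eqmod gamma%:R (psi_prod n)^`() 0.
Proof.
elim: n => [|n [h IHn]].
  by exists 0; rewrite /psi_prod big_ord0 -polyC1 derivC; ring.
rewrite /psi_prod big_ord_recr /= -/(psi_prod n) derivM IHn derivD derivC.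
rewrite wpoly_exp mul_polyC derivZ derivXn -['X^_ *+ _]mulr_natr scalerAl natrM.
move: (eps *: _) (eps *: _) (3 ^ n)%:R => X Y c.
exists (h * (1 + Y) + psi_prod n * (X * c)); ring.
Qed.

Lemma eqmod_deriv_psi0 : eqmod gamma%:R (ser_deriv Psi) 0.
Proof.
apply/eqmod_serP => n; have /eqmod_polyP/(_ n) := eqmod_deriv_psi_prod0 n.+2.
by rewrite subr0 coef_deriv coef_psi_prod // subr0.
Qed.

(** By Frobenius the product is [W^M - 3 h] with [M = 1 + 3 + ... + 3^(n-1)]. It divides
    [(W^M)^n - (3 h)^n], where the second power vanishes modulo [3^n]; [U] is the cofactor. *)
Lemma psi_prod_unit n :
  exists U m, eqmod (3 ^ n)%:R (psi_prod n * U) (Wpoly ^+ m).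
Proof.
pose M := (\sum_(j < n) 3 ^ j)%N.
have [h WE] : eqmod 3%:R (Wpoly ^+ M) (psi_prod n).
  rewrite expr_sum /psi_prod.
  elim/big_ind2: _ => [|x x' y y' xx' yy'|j _]; first exact: eqmod_refl.
    exact: eqmodM.
  exact: Wpoly_frobenius.
exists (\sum_(i < n) (Wpoly ^+ M) ^+ (n.-1 - i) * (3%:R * h) ^+ i), (M * n)%N.
have -> : psi_prod n = Wpoly ^+ M - 3%:R * h by rewrite WE addrK.
by rewrite -subrXX exprM exprMn -natrX; exists (- h ^+ n); ring.
Qed.
End Psi.

(** Since [eps^(3^N) = eps], the factors from index [N] on are those of the same product with
    [z^(gamma 3^N)] in place of [z^gamma]. *)
Lemma psi_prodD (eps : int) (gamma N L : nat) : eps = 1 \/ eps = -1 ->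
  psi_prod eps gamma (N + L) =
  psi_prod eps gamma N * psi_prod eps (gamma * 3 ^ N) L.
Proof.
move=> eps_unit; elim: L => [|L IHL].
  by rewrite addn0 /psi_prod big_ord0 mulr1.
rewrite addnS /psi_prod !big_ord_recr /= -!/(psi_prod _ _ _) IHL mulrA.
by rewrite !wpoly_exp // expnD mulnA.
Qed.

Lemma psi_split (eps : int) (gamma N : nat) :
    eps = 1 \/ eps = -1 -> (0 < gamma)%N ->
  psi eps gamma = ser_of_poly (psi_prod eps gamma N) * psi eps (gamma * 3 ^ N).
Proof.
move=> eps_unit gamma_gt0.
have gamma3_gt0 : (0 < gamma * 3 ^ N)%N by rewrite muln_gt0 gamma_gt0 expn_gt0.
apply/funext => n.
(* With [N + n.+1] factors, [n.+1] remain in the tail, enough for its coefficients up to [z^n]. *)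
rewrite -(coef_psi_prod eps_unit gamma_gt0 (leq_addl N n.+1)).
rewrite psi_prodD //.
apply: (@coef_mul_agree n) => // i le_in.
exact: coef_psi_prod.
Qed.

(** Write [Psi = P Phi]. The tail [Phi] is a series in [z^(gamma 3^N)], so [Phi' = 0] modulo [3^N],
    and [Psi] and [P] have the same logarithmic derivative, stated here without division. *)
Lemma psi_deriv (eps : int) (gamma N : nat) :
    eps = 1 \/ eps = -1 -> (0 < gamma)%N ->
  let P := psi_prod eps gamma N in
  eqmod (3 ^ N)%:R (ser_of_poly P * ser_deriv (psi eps gamma))
    (ser_of_poly P^`() * psi eps gamma).
Proof.
move=> eps_unit gamma_gt0 P; rewrite (psi_split N eps_unit gamma_gt0).
have [|h dPhi] := @eqmod_deriv_psi0 eps (gamma * 3 ^ N) eps_unit.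
  by rewrite muln_gt0 gamma_gt0 expn_gt0.
rewrite ser_derivM ser_deriv_poly -/P dPhi natrM.
by exists (ser_of_poly P ^+ 2 * gamma%:R * h); ring.
Qed.

Lemma Wpoly_inv (eps : int) (gamma : nat) : (0 < gamma)%N ->
  ser_of_poly (Wpoly eps gamma) * inv_lin eps gamma = 1.
Proof.
move=> gamma_gt0; rewrite rmorphD rmorph1 rmorphM.
rewrite mulrDl mul1r -mulrA -ser_scaleE.
apply/funext => n; rewrite coef_serD /ser_scale coef_serXnM /inv_lin.
transitivity (ser_one n) => //; rewrite /ser_one.
have [lt_n|le_n] := ltnP n gamma.
  rewrite mulr0 addr0.
  case: eqP => [-> | /eqP n0]; first by rewrite dvdn0 div0n.
  by rewrite gtnNdvd // lt0n.
rewrite dvdn_subl //; case: ifP => [dvd_n | _]; last first.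
  by rewrite mulr0 addr0; case: eqP le_n => // ->; rewrite leqNgt gamma_gt0.
rewrite -{1}(subnK le_n) divnDr // divnn gamma_gt0 addn1 exprS mulNr addNr.
by case: eqP le_n => // ->; rewrite leqNgt gamma_gt0.
Qed.

(** * Polynomials in Psi modulo a power of 3 *)

Section PsiAlgebraic.
Variables (eps : int) (gamma N : nat).
Local Notation sop := ser_of_poly.
Local Notation Psi := (psi eps gamma).
Local Notation W := (Wpoly eps gamma).
Local Notation eval_psi q := (map_poly sop q).[Psi].
Local Notation eqN := (eqmod (3 ^ N)%:R).

(* The power series in Z[z, 1/z, 1/(1 + eps z^gamma), Psi] modulo 3^N, with
   denominators cleared. *)
Definition psi_algebraic (f : series) :=
  exists k m (q : {poly {poly int}}),
    eqN (sop ('X^k * W ^+ m) * f) (eval_psi q).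

Local Notation alg := psi_algebraic.

Lemma psi_algebraic_horner (q : {poly {poly int}}) : alg (eval_psi q).
Proof.
by exists 0%N, 0%N, q; rewrite !mulr1 rmorph1 mul1r; exact: eqmod_refl.
Qed.

Lemma psi_algebraic_poly p : alg (sop p).
Proof. by have := psi_algebraic_horner p%:P; rewrite map_polyC hornerC. Qed.

Lemma psi_algebraic_psi : alg Psi.
Proof. by have := psi_algebraic_horner 'X; rewrite map_polyX hornerX. Qed.

Lemma psi_algebraic_eqmod f g : eqN f g -> alg g -> alg f.
Proof.
move=> fg [k [m [q gq]]]; exists k, m, q.
exact: eqmod_trans (eqmodMl _ fg) gq.
Qed.

(** Allows division by [z] and [W] whenever the quotient is a power series. *)
Lemma psi_algebraic_div k m f : alg (sop ('X^k * W ^+ m) * f) -> alg f.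
Proof.
case=> k' [m' [q fq]]; exists (k' + k)%N, (m' + m)%N, q.
rewrite !exprD; move: fq; rewrite mulrA -rmorphM mulrACA; exact.
Qed.

Lemma psi_algebraicM f g : alg f -> alg g -> alg (f * g).
Proof.
move=> [k [m [q fq]]] [k' [m' [q' gq]]].
exists (k + k')%N, (m + m')%N, (q * q').
rewrite [map_poly _ _]rmorphM /= hornerM !exprD mulrACA rmorphM mulrACA.
exact: eqmodM.
Qed.

Lemma psi_algebraicD f g : alg f -> alg g -> alg (f + g).
Proof.
move=> [k [m [q fq]]] [k' [m' [q' gq]]].
apply: (@psi_algebraic_div (k + k') (m + m')).
set a := 'X^k * W ^+ m in fq; set b := 'X^k' * W ^+ m' in gq.
have -> : sop ('X^(k + k') * W ^+ (m + m')) * (f + g) =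
          sop b * (sop a * f) + sop a * (sop b * g).
  by rewrite /a /b !exprD !rmorphM; ring.
apply: (psi_algebraic_eqmod (eqmodD (eqmodMl _ fq) (eqmodMl _ gq))).
have := psi_algebraic_horner (b%:P * q + a%:P * q').
by rewrite rmorphD !rmorphM /= !map_polyC hornerD !hornerM !hornerC.
Qed.

Lemma psi_algebraicN f : alg f -> alg (- f).
Proof.
move=> alg_f; rewrite -mulN1r -(rmorph1 sop) -rmorphN.
exact/psi_algebraicM/alg_f/psi_algebraic_poly.
Qed.

Lemma psi_algebraicX n f : alg f -> alg (f ^+ n).
Proof.
move=> alg_f; elim: n => [|n IHn]; last by rewrite exprS; apply: psi_algebraicM.
by rewrite expr0 -(rmorph1 sop); apply: psi_algebraic_poly.
Qed.

Hypotheses (eps_unit : eps = 1 \/ eps = -1) (gamma_gt0 : (0 < gamma)%N).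

Lemma psi_algebraic_inv_lin : alg (inv_lin eps gamma).
Proof.
apply: (@psi_algebraic_div 0 1); rewrite mul1r expr1 Wpoly_inv //.
rewrite -(rmorph1 sop).
exact: psi_algebraic_poly.
Qed.

(** Modulo [3^N], [W^m Psi' = U P Psi' = U P' Psi], where [P] is the [N]-th partial product. *)
Lemma psi_algebraic_deriv_psi : alg (ser_deriv Psi).
Proof.
have [U [m PU]] := psi_prod_unit eps gamma N.
apply: (@psi_algebraic_div 0 m); rewrite mul1r.
have {}PU := eqmod_rmorph sop PU; rewrite rmorph_nat in PU.
apply: psi_algebraic_eqmod (eqmodM (eqmod_sym PU) (eqmod_refl _ _)) _.
rewrite rmorphM mulrAC mulrC.
apply: psi_algebraic_eqmod (eqmodMl _ (psi_deriv N eps_unit gamma_gt0)) _.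
apply: psi_algebraicM; first exact: psi_algebraic_poly.
by apply: psi_algebraicM (psi_algebraic_poly _) psi_algebraic_psi.
Qed.

(** With [D = z^k W^m] and [D f = q(Psi)], use [D f' = (D f)' - D' f]; the derivative of [q(Psi)] is
    treated by induction on [q]. *)
Lemma psi_algebraic_deriv f : alg f -> alg (ser_deriv f).
Proof.
move=> alg_f; have [k [m [q fq]]] := alg_f.
apply: (@psi_algebraic_div k m).
have := eqmod_deriv fq; rewrite ser_derivM => /eqmodD/(_ (eqmod_refl _ _)).
move=> /(_ (- (ser_deriv (sop ('X^k * W ^+ m)) * f))).
rewrite addrAC subrr add0r => /psi_algebraic_eqmod; apply.
apply: psi_algebraicD; last first.
  apply/psi_algebraicN/psi_algebraicM/alg_f; rewrite ser_deriv_poly.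
  exact: psi_algebraic_poly.
elim/poly_ind: q {fq} => [|q c IHq].
  rewrite rmorph0 horner0 -(rmorph0 sop) ser_deriv_poly.
  exact: psi_algebraic_poly.
rewrite rmorphD rmorphM /= map_polyX map_polyC hornerMXaddC.
rewrite ser_derivD ser_derivM ser_deriv_poly.
apply/psi_algebraicD/psi_algebraic_poly.
apply: psi_algebraicD; apply: psi_algebraicM => //.
- exact: psi_algebraic_psi.
- exact: psi_algebraic_horner.
- exact: psi_algebraic_deriv_psi.
Qed.

Lemma psi_algebraic_eval_monomial s mo f :
  alg f -> alg (eval_monomial s f mo).
Proof.
case: mo => [[c a] es] alg_f; rewrite /eval_monomial ser_scaleE ser_XnE.
do 2![apply: psi_algebraicM; first exact: psi_algebraic_poly].
elim: (iota 0 s.+1) => [|j js IHj] /=.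
  by rewrite -[ser_one](rmorph1 sop); apply: psi_algebraic_poly.
apply: psi_algebraicM => //; rewrite ser_powE; apply: psi_algebraicX.
by elim: j {IHj} => //= j; apply: psi_algebraic_deriv.
Qed.

Lemma psi_algebraic_eval_Q s Q f : alg f -> alg (eval_Q s Q f).
Proof.
move=> alg_f; elim: Q => [|mo Q IHQ] /=.
  by rewrite -[ser_zero](rmorph0 sop); apply: psi_algebraic_poly.
by apply: psi_algebraicD => //; apply: psi_algebraic_eval_monomial.
Qed.

(* H need not be divisible by z^k: only its coefficients from z^k on matter. *)
Lemma psi_algebraic_divXn (c k : nat) (f H : series) : alg H ->
  eqmod c%:R (sop 'X^k * f) H -> exists2 g, alg g & eqmod c%:R f g.
Proof.
move=> alg_H /eqmod_serP fH; exists (fun n => H (k + n)%N); last first.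
  apply/eqmod_serP => n; have := fH (k + n)%N.
  by rewrite coef_serXnM ltnNge leq_addr addKn.
apply: (@psi_algebraic_div k 0); rewrite mulr1.
(* Dropping the coefficients of [H] below [z^k] only subtracts a polynomial. *)
have -> : sop 'X^k * (fun n => H (k + n)%N : int) = H - sop (\poly_(i < k) H i).
  apply/funext => n.
  rewrite coef_serXnM coef_serD coef_serN /ser_of_poly coef_poly.
  by case: ltnP => [_|le_kn]; rewrite ?subrr // subnKC // subr0.
exact/psi_algebraicD/psi_algebraicN/psi_algebraic_poly.
Qed.
End PsiAlgebraic.

(** Take the remainder of [q] by [d = (W Y^2 - 1)^N], which has degree [2 N] in [Y] and vanishes at
    [Psi] modulo [3^N]. *)
Lemma psi_algebraic_reduce (eps : int) (gamma N : nat) (f : series) :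
    eps = 1 \/ eps = -1 -> (0 < gamma)%N -> psi_algebraic eps gamma N f ->
  exists k m (r : {poly {poly int}}), (size r <= 2 * N)%N /\
    eqmod (3 ^ N)%:R (ser_of_poly ('X^k * Wpoly eps gamma ^+ m) * f)
      (map_poly ser_of_poly r).[psi eps gamma].
Proof.
move=> eps_unit gamma_gt0 [k [m [q fq]]].
set W := Wpoly eps gamma in fq *; set Psi := psi eps gamma in fq *.
have W_neq0 : W != 0.
  apply: contra_eq_neq (Wpoly_inv eps gamma_gt0) => W0.
  by rewrite -/W W0 rmorph0 mul0r eq_sym oner_neq0.
pose d0 : {poly {poly int}} := W *: 'X^2 - 1.
have size_W : size (W *: 'X^2) = 3 by rewrite size_scale // size_polyXn.
have size_d0 : size d0 = 3.
  by rewrite size_polyDl size_W // size_polyN size_poly1.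
have d0_neq0 : d0 != 0 by rewrite -size_poly_gt0 size_d0.
have lead_d0 : lead_coef d0 = W.
  rewrite lead_coefDl ?size_W ?size_polyN ?size_poly1 //.
  by rewrite lead_coefZ lead_coefXn mulr1.
pose d := d0 ^+ N.
have d_neq0 : d != 0 by rewrite expf_neq0.
have size_d : size d = (2 * N).+1.
  by rewrite -(prednK (_ : 0 < size d)%N) ?size_poly_gt0 // size_exp size_d0.
have lead_d : lead_coef d = W ^+ N by rewrite lead_coef_exp lead_d0.
have d_Psi : eqmod (3 ^ N)%:R (map_poly ser_of_poly d).[Psi] 0.
  rewrite rmorphXn /= horner_exp natrX; apply: eqmod_exp0.
  rewrite rmorphB rmorph1 /= map_polyZ map_polyXn hornerD hornerN hornerZ.
  rewrite hornerXn hornerC.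
  exact: (eqmod_subr0 _ _ _).1 (psi_square eps_unit gamma_gt0).
(* The leading coefficient [W^N] is not a unit of [{poly int}], so this is a pseudo-division; the
   power of [W] it puts before [q] joins the denominator. *)
have Wq := Pdiv.Idomain.divp_eq q d; rewrite lead_d -exprM in Wq.
exists k, (m + N * Pdiv.Idomain.scalp q d)%N, (q %% d); split.
  by rewrite -ltnS -size_d ltn_modpN0.
rewrite exprD mulrA [_ * W ^+ (_ * _)]mulrC rmorphM -mulrA.
apply: eqmod_trans (eqmodMl _ fq) _.
rewrite -hornerZ -map_polyZ Wq rmorphD rmorphM hornerD hornerM /=.
rewrite -[X in eqmod _ _ X]add0r; apply: eqmodD (eqmod_refl _ _).
rewrite -[X in eqmod _ _ X](mulr0 (map_poly ser_of_poly (q %/ d)).[Psi]).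
exact: eqmodMl.
Qed.

(** For the Newton step: a change of [F] by a multiple of [3^(b+1)] changes [3 Q] by a multiple of
    [3^(b+2)], so [Q] does not enter the derivative. *)
Lemma eqmod_eval_Q (c : nat) s Q (f g : series) :
  eqmod c%:R f g -> eqmod c%:R (eval_Q s Q f) (eval_Q s Q g).
Proof.
move=> fg; elim: Q => [|[[a k] es] Q IHQ]; first exact: eqmod_refl.
apply: eqmodD => //; rewrite /eval_monomial !ser_scaleE; do 2!apply: eqmodMl.
elim: (iota 0 s.+1) => [|j js IHj] /=; first exact: eqmod_refl.
apply: eqmodM => //; rewrite !ser_powE; apply: eqmodX.
by elim: j {IHj} => //= j; apply: eqmod_deriv.
Qed.

Lemma lcoefXnM k (f : series) n :
  lcoef k (ser_of_poly 'X^k * f) n = lcoef 0 f n.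
Proof.
rewrite /lcoef addr0; case: n => n.
  by rewrite lez_nat /= coef_serXnM ltnNge leq_addl addnK.
case: ifP => // n_k; rewrite coef_serXnM.
by have -> : (absz (Negz n + k%:Z)%R < k)%N by lia.
Qed.

(** * Lifting the solution *)

Section Lifting.
Variables (eps : int) (gamma N : nat) (F : series) (c0 c1 c2 : {poly int}).
Variables (s : nat) (Q : mpoly).
Hypotheses (eps_unit : eps = 1 \/ eps = -1) (gamma_gt0 : (0 < gamma)%N).
Local Notation sop := ser_of_poly.
Local Notation Psi := (psi eps gamma).
Local Notation W := (Wpoly eps gamma).
Local Notation alg := (psi_algebraic eps gamma N).
Local Notation I := (inv_lin eps gamma).
Hypothesis F_eqn : eqn_lhs c0 c1 c2 s Q F = 0.

Lemma eqn_lhsE G : eqn_lhs c0 c1 c2 s Q G =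
  sop c2 * G ^+ 2 + sop c1 * G + sop c0 + 3%:R * eval_Q s Q G.
Proof.
rewrite /eqn_lhs ser_scaleE (_ : 3%:P = 3%:R) ?polyC_natr // rmorph_nat.
by rewrite -!addrA.
Qed.

(** As [-2 = 1] modulo 3, completing the square gives [(c2 F - c1)^2 = c1^2 - c0 c2]. Multiplied by
    [W Psi^2 = 1], the right side becomes the square of [R], and the domain property leaves a
    sign. *)
Lemma discriminant_root f1 f2 :
  eqmod 3%:R (c1 ^+ 2 - c0 * c2) ('X^(2 * f1) * W ^+ (2 * f2 + 1)) ->
  exists sg : bool, eqmod 3%:R (sop c2 * F - sop c1)
    ((-1) ^+ sg * (sop ('X^f1 * W ^+ f2.+1) * Psi)).
Proof.
move=> disc; set R := sop _ * Psi.
have R2 : eqmod 3%:R (sop (c1 ^+ 2 - c0 * c2)) (R ^+ 2).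
  have := eqmod_rmorph sop disc; rewrite rmorph_nat => /eqmod_trans; apply.
  have -> : R ^+ 2 = sop ('X^(2 * f1) * W ^+ (2 * f2 + 1)) * (sop W * Psi ^+ 2).
    rewrite /R (mulnC 2 f1) (mulnC 2 f2) exprD exprM exprM expr1.
    rewrite [W ^+ f2.+1]exprS !rmorphM /=.
    move: (sop W) (sop 'X^f1) (sop (W ^+ f2)) => w x y; ring.
  rewrite -[X in eqmod _ X]mulr1; apply: eqmodMl; apply: eqmod_sym.
  exact: psi_square.
have /(eqmod_ser_mul_eq0 (isT : prime 3))[] :
    eqmod 3%:R ((sop c2 * F - sop c1 - R) * (sop c2 * F - sop c1 + R)) 0.
- have [h R2E] := eqmod_sym R2; have := F_eqn; rewrite eqn_lhsE => FE.
  have -> : (sop c2 * F - sop c1 - R) * (sop c2 * F - sop c1 + R) =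
    (sop c2 * F - sop c1) ^+ 2 - R ^+ 2 by ring.
  rewrite R2E rmorphB rmorphXn rmorphM.
  (* The difference of squares is [c2] times the equation for [F], plus three times this witness. *)
  exists (- sop c2 * (eval_Q s Q F + sop c1 * F) - h).
  rewrite add0r -[RHS]addr0 -[X in _ = _ + X](mulr0 (sop c2)) -FE; ring.
- by move=> R0; exists false; rewrite expr0 mul1r; apply/eqmod_subr0.
- move=> R0; exists true; rewrite expr1 mulN1r.
  by apply/eqmod_subr0; rewrite opprK.
Qed.

Variables (e1 e2 f1 f2 : nat).
Hypothesis c2E : eqmod 3%:R c2 ('X^e1 * W ^+ e2).
Hypothesis disc :
  eqmod 3%:R (c1 ^+ 2 - c0 * c2) ('X^(2 * f1) * W ^+ (2 * f2 + 1)).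

(** Newton iteration on [b]. The precision [b.+1] of the approximation is independent of the modulus
    [3^N] in [alg]. *)
Lemma solution_psi_algebraic b : exists2 P, alg P & eqmod (3 ^ b.+1)%:R F P.
Proof.
have [sg root] := discriminant_root disc.
have sopI m : sop (W ^+ m) * I ^+ m = 1.
  by rewrite rmorphXn -exprMn Wpoly_inv // expr1n.
have algI m : alg (I ^+ m) by exact/psi_algebraicX/psi_algebraic_inv_lin.
have algp p : alg (sop p) by exact: psi_algebraic_poly.
have algPsi : alg Psi by exact: psi_algebraic_psi.
elim: b => [|b [P alg_P FP]].
  (* Modulo 3, [z^e1 W^e2 F = c2 F = c1 + (-1)^sg z^f1 W^(f2+1) Psi]; now divide by [W^e2]. *)
  pose H := I ^+ e2 * (sop c1 + sop ((-1) ^+ sg * ('X^f1 * W ^+ f2.+1)) * Psi).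
  have alg_H : alg H.
    apply: psi_algebraicM => //; apply: psi_algebraicD => //.
    exact: psi_algebraicM.
  apply: (psi_algebraic_divXn (k := e1) alg_H); rewrite expn1.
  have -> : sop 'X^e1 * F = I ^+ e2 * (sop ('X^e1 * W ^+ e2) * F).
    by rewrite -{1}[F]mul1r -(sopI e2) rmorphM; ring.
  apply: eqmodMl; have c2E' := eqmod_rmorph sop c2E.
  rewrite rmorph_nat in c2E'.
  apply: eqmod_trans (eqmodM (eqmod_sym c2E') (eqmod_refl _ _)) _.
  have := eqmodD (eqmod_refl 3%:R (sop c1)) root; rewrite addrC subrK.
  by rewrite [sop (_ ^+ sg * _)]rmorphM rmorphXn rmorphN1 !mulrA.
(* An inverse, up to [z^f1], of the derivative [2 c2 P + c1], which modulo 3 is [-(c2 F - c1)],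
   hence [(-1)^(sg+1) z^f1 W^(f2+1) Psi]; the product with [U] is [z^f1 W Psi^2]. *)
pose U := (-1) ^+ sg.+1 * (I ^+ f2 * Psi).
have alg_U : alg U.
  apply: psi_algebraicM; last exact: psi_algebraicM.
  by apply: psi_algebraicX; rewrite -(rmorph1 sop) -rmorphN.
have UE : eqmod 3%:R (U * (2%:R * sop c2 * P + sop c1)) (sop 'X^f1).
  have FP3 : eqmod 3%:R F P.
    by apply: (@eqmod_dvd _ (3 ^ b)%:R); rewrite -natrM -expnS.
  have [h FE] := FP3; have [l rootE] := root.
  have [t PsiE] := psi_square eps_unit gamma_gt0.
  have -> : 2%:R * sop c2 * P + sop c1 =
      - (sop c2 * F - sop c1) + 3%:R * (sop c2 * (P + h)).
    by rewrite FE; ring.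
  rewrite rootE.
  have -> : U * (- ((-1) ^+ sg * (sop ('X^f1 * W ^+ f2.+1) * Psi) + 3%:R * l)
      + 3%:R * (sop c2 * (P + h))) =
    ((-1) ^+ sg) ^+ 2 * sop 'X^f1 * (sop (W ^+ f2) * I ^+ f2)
      * (sop W * Psi ^+ 2) + 3%:R * (U * (sop c2 * (P + h) - l)).
    by rewrite /U [(-1) ^+ sg.+1]exprS exprS !rmorphM; ring.
  rewrite sqrr_sign sopI PsiE.
  by exists (sop 'X^f1 * t + (U * (sop c2 * (P + h) - l))); ring.
have [G FE] := FP.
have [R QE] := eqmod_eval_Q s Q FP.
have [t tE] := UE.
(* The Newton step multiplied by [z^f1], which keeps it a power series. *)
pose H := sop 'X^f1 * P - U * eqn_lhs c0 c1 c2 s Q P.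
have alg_H : alg H.
  apply: psi_algebraicD; first exact: psi_algebraicM.
  apply/psi_algebraicN/psi_algebraicM; rewrite // eqn_lhsE.
  have alg3 : alg 3%:R by rewrite -(rmorph_nat sop).
  have algQ : alg (eval_Q s Q P) by exact: psi_algebraic_eval_Q.
  have algP2 : alg (P ^+ 2) by exact: psi_algebraicX.
  apply: psi_algebraicD; last exact: psi_algebraicM.
  by apply: psi_algebraicD => //; apply: psi_algebraicD; apply: psi_algebraicM.
apply: (psi_algebraic_divXn (k := f1) alg_H).
have := F_eqn; rewrite eqn_lhsE QE FE => E0.
rewrite /H eqn_lhsE.
set EP := _ + 3%:R * eval_Q s Q P.
(* Taylor expansion of the equation at [P], with [F = P + 3^(b+1) G]. *)
have -> : EP = - (3 ^ b.+1)%:R * ((2%:R * sop c2 * P + sop c1) * G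
    + 3%:R * (3 ^ b)%:R * sop c2 * G ^+ 2 + 3%:R * R).
  rewrite -[RHS]addr0 -[X in _ = _ + X]E0 /EP expnS natrM; ring.
set D := (2%:R * sop c2 * P + sop c1) in tE *.
(* The terms [U D G] now cancel, and all the others carry a further factor 3. *)
have -> : sop 'X^f1 = U * D - 3%:R * t by rewrite tE; ring.
rewrite [(3 ^ b.+2)%N]expnS natrM.
exists (- t * G - U * ((3 ^ b)%:R * sop c2 * G ^+ 2 + R)); ring.
Qed.
End Lifting.

Theorem theorem6p1 (alpha gamma : nat) (eps : int)
  (F : series) (c0 c1 c2 : {poly int}) (s : nat) (Q : mpoly) :
  (0 < alpha)%N -> (0 < gamma)%N -> (eps = 1 \/ eps = -1) ->
  (forall n, eqn_lhs c0 c1 c2 s Q F n = 0) ->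
  (exists e1 e2 : nat,
     poly_cong 3 c2 ('X ^+ e1 * (1 + eps%:P * 'X ^+ gamma) ^+ e2)) ->
  (exists f1 f2 : nat,
     poly_cong 3 (c1 ^+ 2 - c0 * c2)
       ('X ^+ (2 * f1) * (1 + eps%:P * 'X ^+ gamma) ^+ (2 * f2 + 1))) ->
  (forall G H : series,
     ser_cong (3 ^+ (3 ^ alpha)) (eqn_lhs c0 c1 c2 s Q G) ser_zero ->
     ser_cong (3 ^+ (3 ^ alpha)) (eqn_lhs c0 c1 c2 s Q H) ser_zero ->
     ser_cong (3 ^+ (3 ^ alpha)) G H) ->
  exists a : 'I_(2 * 3 ^ alpha) -> lelem,
    forall n : int,
      (3 ^+ (3 ^ alpha) %|
         lcoef 0 F n - \sum_(i < 2 * 3 ^ alpha) term_coef eps gamma (a i) i n)%Z.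
Proof.
move=> _ gamma_gt0 eps_unit F_eqn [e1 [e2 c2E]] [f1 [f2 disc]] _.
move: (3 ^ alpha)%N => N.
have F_root : eqn_lhs c0 c1 c2 s Q F = 0 by apply/funext.
have [P alg_P FP] := solution_psi_algebraic N eps_unit gamma_gt0 F_root
  ((eqmod_polyP 3 _ _).1 c2E) ((eqmod_polyP 3 _ _).1 disc) N.
rewrite expnSr natrM in FP.
have alg_F := psi_algebraic_eqmod (eqmod_dvd FP) alg_P.
have [k [m [r [size_r Fr]]]] := psi_algebraic_reduce eps_unit gamma_gt0 alg_F.
(* All [a_i] share the denominator [z^k W^m]. *)
exists (fun i => (r`_i, k, m)) => n.
pose T (i : 'I_(2 * N)) : series :=
  ser_of_poly r`_i * (inv_lin eps gamma ^+ m * psi eps gamma ^+ i).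
have FT : eqmod (3 ^ N)%:R (ser_of_poly 'X^k * F) (\sum_i T i).
  have -> : ser_of_poly 'X^k * F =
      inv_lin eps gamma ^+ m * (ser_of_poly ('X^k * Wpoly eps gamma ^+ m) * F).
    have WI : (ser_of_poly (Wpoly eps gamma) * inv_lin eps gamma) ^+ m = 1.
      by rewrite Wpoly_inv // expr1n.
    by rewrite -[LHS]mulr1 -WI exprMn rmorphM (rmorphXn _ m); ring.
  have -> : \sum_i T i =
      inv_lin eps gamma ^+ m * (map_poly ser_of_poly r).[psi eps gamma].
    rewrite (@horner_coef_wide _ (2 * N)) ?(leq_trans (size_poly _ _)) //.
    rewrite mulr_sumr; apply: eq_bigr => i _; rewrite coef_map /T /=; ring.
  exact: eqmodMl.
have -> : \sum_(i < 2 * N) term_coef eps gamma (r`_i, k, m) i n =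
    lcoef k (\sum_i T i) n.
  rewrite /term_coef /lcoef; case: ifP => _; last by rewrite big1.
  by rewrite coef_ser_sum; apply: eq_bigr => i _; rewrite !ser_powE.
(* Both Laurent series are now [z^(-k)] times a power series, so they vanish below [z^(-k)] and [FT]
   compares the rest. *)
rewrite -(lcoefXnM k) /lcoef; case: ifP => _; last by rewrite subrr dvdz0.
by have /eqmod_serP/(_ `|(n + k%:Z)%R|%N) := FT; rewrite natrX.
Qed.
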